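(* Every APK-compatible pair $(\tilde U,\tilde H)$ such that $\mathrm{ann}(\tilde U)\cap(\mathrm{ann}(\tilde U))^\bot\neq\{0\}$ is an APK double extension of another APK-compatible pair $(U,H)$ by a one-dimensional algebra. As a consequence, every APK-compatible pair $(\tilde U,\tilde H)$ either is (up to isomorphism of complex algebras preserving the hermitian forms) the pair corresponding to an algebra of type $\mathfrak{aff}(\mathcal A)$ with its standard pseudo-Kähler structure, or can be obtained by a (finite) series of APK double extensions starting from the pair associated to an algebra $\mathfrak{aff}(\mathcal A)$, where $\mathcal A$ is a real symmetric associative commutative algebra.
   Context: All algebras are finite dimensional. Hermitian forms are $\mathbb C$-linear in the first argument, conjugate-linear in the second, and not assumed definite. Let $U$ be a complex associative commutative algebra (not necessarily unital, possibly zero) with a non-degenerate hermitian form $H$; $R_z$ denotes multiplication by $z$ in $U$, and $F^*$ the $H$-adjoint of a $\mathbb C$-linear map $F$, $H(F^*x,y)=H(x,Fy)$. The pair $(U,H)$ is APK-compatible if $xR_z^*y=yR_z^*x$ for all $x,y,z\in U$. $\mathrm{ann}(U)=\{x\in U: xU=0\}$, and $W^\bot$ is the $H$-orthogonal of a subspace $W$. APK double extension of an APK-compatible pair $(U,H)$ by a one-dimensional algebra: the data are $\varepsilon,\alpha_0\in\mathbb C$, $a_0,b_0\in U$, a $\mathbb C$-linear map $D:U\to U$ and a semilinear (conjugate-linear) map $\tau:U\to U$ such that, for all $x,y\in U$: $D(xy)=(Dx)y$, $D^2-\varepsilon D=R_{a_0}$, $H(x,\tau y)=\overline{H(\tau x,y)}$,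 $\tau a_0=(D^*-\overline{\varepsilon}\,\mathrm{id})b_0$, $\tau^2=DD^*=R_{b_0}$, $\tau b_0=Db_0$, $\tau R_x^*=R_x\tau$, $\tau R_x=R_x^*\tau$, $D\tau=\tau D^*$, $DR_x^*=R_{\tau x}$, $\tau Dx=R_x^*b_0$. The double extension is $\tilde U=\mathbb Cv_0\oplus U\oplus\mathbb Cu_0$ with the commutative product $\star$ given by: $u_0$ annihilates $\tilde U$, $v_0\star v_0=\varepsilon v_0+a_0+\alpha_0u_0$, $x\star y=xy+H(x,\tau y)u_0$, $v_0\star x=Dx+H(x,b_0)u_0$ for $x,y\in U$, and with the hermitian form $\tilde H$ given by $\tilde H(u_0,v_0)=1$, $\tilde H(u_0,u_0)=\tilde H(v_0,v_0)=\tilde H(u_0,x)=\tilde H(v_0,x)=0$, $\tilde H(x,y)=H(x,y)$ for $x,y\in U$. A real symmetric associative commutative algebra is a real associative commutative algebra $\mathcal A$ with a non-degenerate symmetric bilinear form $B:\mathcal A\times\mathcal A\to\mathbb R$ such that $B(ab,c)=B(a,bc)$. The Lie algebra $\mathfrak{aff}(\mathcal A)=\mathcal A\oplus\mathcal A$ has bracket $[(a,b),(a',b')]=(0,ab'-a'b)$; its standard pseudo-Kähler structure is $J(a,b)=(-b,a)$, $\omega((a,b),(a',b'))=B(a,b')-B(b,a')$. The APK-compatible pair corresponding to $\mathfrak{aff}(\mathcal A)$ with this structure is $(\mathcal A^{\mathbb C},H)$, where $\mathcal A^{\mathbb C}$ is the complexification and $H(a+ib,a'+ib')=-4B(a,a')-4B(b,b')-4i\,(B(b,a')-B(a,b'))$.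 *)

(* Defs.v *)
(* The field of real numbers is an arbitrary
   R : realType and the field of complex numbers is R[i].  Finite-dimensional
   spaces are vectTypes, so the zero space is allowed and no unit is assumed. *)
From HB Require Import structures.
From mathcomp Require Import all_boot all_order all_algebra sesquilinear.
From mathcomp Require Import complex.
From mathcomp Require Import boolp classical_sets reals.
From mathcomp Require Import ring.
From Stdlib Require Import Relation_Operators.

Set Implicit Arguments.
Unset Strict Implicit.
Unset Printing Implicit Defensive.

Import Order.TTheory GRing.Theory Num.Theory.

Local Open Scope ring_scope.
Local Open Scope complex_scope.

(* A complex algebra with a hermitian form, linear in the first argument and
   conjugate-linear in the second.  No further axiom is included here. *)
Record herm_alg (R : realType) := HermAlg {
  ha_space :> vectType R[i];
  ha_mul : {bilinear ha_space -> ha_space -> ha_space};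
  ha_form : {hermitian ha_space for false & @Num.conj R[i]} }.

Section Hermitian.
Variables (R : realType) (U : vectType R[i]).
Variable H : {hermitian U for false & @Num.conj R[i]}.

(* The adjoint exists and is unique when H is non-degenerate and F is linear
   (adjP, adj_unique); otherwise the value 0 may be returned. *)
Definition adj (F : U -> U) (x : U) : U :=
  xget 0 [set w | forall y, H w y = H x (F y)]%classic.

Lemma nondegenerate_inj (u v : U) :
  nondegenerate H -> (forall y, H u y = H v y) -> u = v.
Proof.
move=> /eqP ndH euv; apply/eqP; rewrite -subr_eq0 -memv0 -ndH.
by apply/mem_orthovP => y _; rewrite linearBl/= euv subrr.
Qed.

Lemma adj_unique (F G : U -> U) : nondegenerate H ->
  (forall x y, H (G x) y = H x (F y)) -> adj F =1 G.
Proof.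
move=> ndH FG x; apply: (nondegenerate_inj ndH) => y; rewrite FG.
by rewrite /adj; case: xgetP => [w _ -> //|/(_ (G x))[]] z; exact: FG.
Qed.

Lemma adjP (F : {linear U -> U}) x y : nondegenerate H ->
  H (adj F x) y = H x (F y).
Proof.
move=> ndH; rewrite /adj; case: xgetP => [w _ -> //|noadj]; exfalso.
pose e := vbasis {:U}; pose n := \dim {:U}.
pose row (g : U -> R[i]) := \row_(i < n) g e`_i.
have row_lin : linear (fun w => row (H w) : 'rV[R[i]]_n).
  by move=> a u v; apply/rowP => i; rewrite !mxE linearDl linearZl_LR.
pose rowL := HB.pack_for {linear U -> 'rV[R[i]]_n} (fun w => row (H w))
  (GRing.isLinear.Build _ _ _ _ _ row_lin).
have He (g : U -> R[i]) w : (forall a u v, g (a *: u + v) = a^* * g u + g v) ->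
    row (H w) = row g -> H w =1 g.
  move=> gl Hg z; have g0 : g 0 = 0.
    by have /eqP := gl 1 0 0; rewrite scale1r addr0 rmorph1 mul1r
      -[X in X == _]addr0 (inj_eq (addrI _)) eq_sym => /eqP.
  rewrite (coord_vbasis (memvf z)) linear_sumr /=.
  apply: (big_ind2 (fun a u => a = g u)) => [||i _]; first by rewrite g0.
    by move=> _ u _ v -> ->; have := gl 1 u v; rewrite scale1r rmorph1 mul1r.
  rewrite linearZr_LR /=; have := gl (coord e i z) e`_i 0.
  rewrite !addr0 g0 addr0 => ->; congr (_ * _).
  by have /rowP/(_ i) := Hg; rewrite !mxE.
have ker0 : lker (linfun rowL) = 0%VS.
  apply/eqP; rewrite -subv0; apply/subvP => w; rewrite memv_ker lfunE /=.
  move=> /eqP w0; rewrite memv0; apply/eqP/(nondegenerate_inj ndH) => z.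
  rewrite linear0l; apply: (He (fun=> 0)) => [a u v|].
    by rewrite mulr0 addr0.
  by rewrite w0; apply/rowP => i; rewrite !mxE.
have full : limg (linfun rowL) = fullv.
  apply/eqP; rewrite eqEdim subvf /=.
  have := limg_ker_dim (linfun rowL) fullv.
  by rewrite ker0 capv0 dimv0 add0n => ->; rewrite dimvf /dim /= mul1n.
have : row (fun y => H x (F y)) \in limg (linfun rowL) by rewrite full memvf.
move=> /memv_imgP[w _]; rewrite lfunE /= => /esym Hw.
apply: (noadj w) => z; apply: (He (fun y => H x (F y)) w _ Hw) => a u v.
by rewrite !linearP.
Qed.

End Hermitian.

Section APK.
Variable R : realType.
Implicit Types X Y : herm_alg R.

Local Notation "x ** y" := (ha_mul _ x y) (at level 40, left associativity).

Definition APK_compatible X :=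
  [/\ commutative (@ha_mul R X), associative (@ha_mul R X),
      nondegenerate (ha_form X) &
      forall x y z : X,
        x ** adj (ha_form X) (ha_mul X z) y
        = y ** adj (ha_form X) (ha_mul X z) x].

Definition ann X : {vspace X} :=
  (\bigcap_(i < \dim {:X}) lker (linfun (applyr (ha_mul X) (vbasis {:X})`_i)))%VS.

Lemma annP X (x : X) : reflect (forall y : X, x ** y = 0) (x \in ann X).
Proof.
apply: (iffP idP) => [xann y|x0].
  rewrite (coord_vbasis (memvf y)) linear_sumr big1 // => i _.
  move: xann => /subv_bigcapP/(_ i isT).
  by rewrite -memvE memv_ker lfunE /= linearZr_LR => /eqP ->; rewrite scaler0.
by apply/subv_bigcapP => i _; rewrite -memvE memv_ker lfunE /= x0.
Qed.

Definition isomorphic X Y := exists f : {linear X -> Y},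
  [/\ bijective f,
      forall x y, f (x ** y) = f x ** f y &
      forall x y, ha_form Y (f x) (f y) = ha_form X x y].

Record dext_data X := DextData {
  de_eps : R[i];
  de_alpha0 : R[i];
  de_a0 : X;
  de_b0 : X;
  de_D : {linear X -> X};
  de_tau : {linear X -> X | @Num.conj R[i] \; *:%R} }.

Record dext_axioms X (d : dext_data X) : Prop := DextAxioms {
  de_DM : forall x y : X, de_D d (x ** y) = de_D d x ** y;
  de_DD : forall x,
    de_D d (de_D d x) - de_eps d *: de_D d x = de_a0 d ** x;
  de_form_tau : forall x y,
    ha_form X x (de_tau d y) = Num.conj (ha_form X (de_tau d x) y);
  de_tau_a0 : de_tau d (de_a0 d)
    = adj (ha_form X) (de_D d) (de_b0 d) - Num.conj (de_eps d) *: de_b0 d;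
  de_tau_tau : forall x, de_tau d (de_tau d x) = de_b0 d ** x;
  de_D_adjD : forall x, de_D d (adj (ha_form X) (de_D d) x) = de_b0 d ** x;
  de_tau_b0 : de_tau d (de_b0 d) = de_D d (de_b0 d);
  de_tau_adjR : forall x y,
    de_tau d (adj (ha_form X) (ha_mul X x) y) = x ** de_tau d y;
  de_tau_R : forall x y,
    de_tau d (x ** y) = adj (ha_form X) (ha_mul X x) (de_tau d y);
  de_D_tau : forall x,
    de_D d (de_tau d x) = de_tau d (adj (ha_form X) (de_D d) x);
  de_D_adjR : forall x y,
    de_D d (adj (ha_form X) (ha_mul X x) y) = de_tau d x ** y;
  de_tau_D : forall x,
    de_tau d (de_D d x) = adj (ha_form X) (ha_mul X x) (de_b0 d) }.

Let addr4ACA (V : zmodType) (a b c e a' b' c' e' : V) :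
  (a + b + c + e) + (a' + b' + c' + e')
  = (a + a') + (b + b') + (c + c') + (e + e').
Proof. by rewrite addrACA (addrACA (a + b)) (addrACA a). Qed.

Let hlin_l X (y : X) a (u v : X) :
  ha_form X (a *: u + v) y = a * ha_form X u y + ha_form X v y.
Proof. by rewrite linearDl linearZl_LR. Qed.

Let hlin_r X (y : X) a (u v : X) :
  ha_form X y (a *: u + v) = Num.conj a * ha_form X y u + ha_form X y v.
Proof. by rewrite linearDr linearZr_LR. Qed.

Section DoubleExtension.
Variables (X : herm_alg R) (d : dext_data X).

(* (s, x, t) stands for s v_0 + x + t u_0. *)
Definition dext_space : vectType R[i] := (R[i]^o * X * R[i]^o)%type.

Definition dext_mul (p q : dext_space) : dext_space :=
  let: (s, x, t) := p in let: (s', x', t') := q in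
  (s * s' * de_eps d,
   (s * s') *: de_a0 d + s *: de_D d x' + s' *: de_D d x + x ** x',
   s * s' * de_alpha0 d + s * ha_form X x' (de_b0 d)
     + s' * ha_form X x (de_b0 d) + ha_form X x (de_tau d x')).

Definition dext_form (p q : dext_space) : R[i] :=
  let: (s, x, t) := p in let: (s', x', t') := q in
  t * Num.conj s' + s * Num.conj t' + ha_form X x x'.

Fact dext_mul_bilinear : bilinear_for
  (GRing.Scale.Law.clone _ _ *:%R _) (GRing.Scale.Law.clone _ _ *:%R _) dext_mul.
Proof.
split=> [[[s' x'] t']|[[s x] t]] a [[u v] w] [[u' v'] w'].
  apply/eqP; rewrite !xpair_eqE /=; apply/andP; split; [apply/andP; split|];
    apply/eqP => /=.
  - by rewrite /GRing.scale /=; ring.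
  - rewrite !linearDl !linearZl_LR linearP /= !scalerDr addr4ACA.
    congr (_ + _ + _ + _); rewrite ?scalerA -?scalerDl //; last first.
      by rewrite [s' * a]mulrC.
    by congr (_ *: _); rewrite /GRing.scale /=; ring.
  - by rewrite !hlin_l /GRing.scale /=; ring.
apply/eqP; rewrite !xpair_eqE /=; apply/andP; split; [apply/andP; split|];
  apply/eqP => /=.
- by rewrite /GRing.scale /=; ring.
- rewrite !linearDr !linearZr_LR linearP /= !scalerDr addr4ACA.
  congr (_ + _ + _ + _); rewrite ?scalerA -?scalerDl //; last first.
    by rewrite [s * a]mulrC.
  by congr (_ *: _); rewrite /GRing.scale /=; ring.
- rewrite !hlin_l linearP /= hlin_r /= conjCK /GRing.scale /=.
  by ring.
Qed.
HB.instance Definition _ :=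
  bilinear_isBilinear.Build _ _ _ _ _ _ dext_mul dext_mul_bilinear.

Fact dext_form_bilinear : bilinear_for
  (GRing.Scale.Law.clone _ _ *%R _)
  (GRing.Scale.Law.clone _ _ (@Num.conj R[i] \; *%R) _) dext_form.
Proof.
split=> [[[s' x'] t']|[[s x] t]] a [[u v] w] [[u' v'] w'] /=.
  by rewrite hlin_l /GRing.scale /=; ring.
by rewrite hlin_r /GRing.scale /= !rmorphD !rmorphM /=; ring.
Qed.
Fact dext_form_hermitian p q :
  dext_form p q = (-1) ^+ false * Num.conj (dext_form q p).
Proof.
case: p q => [[s x] t] [[s' x'] t'].
rewrite /= expr0 mul1r !rmorphD !rmorphM /= !conjCK.
by rewrite (hermC (ha_form X) x) expr0 mul1r /=; ring.
Qed.
HB.instance Definition _ :=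
  bilinear_isBilinear.Build _ _ _ _ _ _ dext_form dext_form_bilinear.
HB.instance Definition _ :=
  isHermitianSesquilinear.Build _ _ _ _ dext_form dext_form_hermitian.

Definition dext : herm_alg R := HermAlg dext_mul dext_form.

End DoubleExtension.

(* Y is, up to isomorphism, an APK double extension of the pair X. *)
Definition APK_double_extension X Y : Prop :=
  APK_compatible X /\
  exists d : dext_data X, dext_axioms d /\ isomorphic Y (dext d).

(* A finite series of at least one APK double extension leads from X to Y. *)
Definition APK_extension_series : herm_alg R -> herm_alg R -> Prop :=
  clos_trans (herm_alg R) APK_double_extension.

End APK.

Record symm_alg (R : realType) := SymmAlg {
  sa_space :> vectType R;
  sa_mul : {bilinear sa_space -> sa_space -> sa_space};
  sa_form : {symmetric sa_space} }.

Definition symmetric_assoc_comm (R : realType) (A : symm_alg R) : Prop :=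
  [/\ commutative (@sa_mul R A), associative (@sa_mul R A),
      nondegenerate (sa_form A) &
      forall a b c : A,
        sa_form A (sa_mul A a b) c = sa_form A a (sa_mul A b c)].

(* The complexification of a real space: (a, b) stands for a + ib. *)
Definition complexification (R : realType) (A : vectType R) : Type :=
  (A * A)%type.

Section Complexification.
Import VectorInternalTheory.
Variables (R : realType) (A : vectType R).
Local Notation AC := (complexification A).

HB.instance Definition _ := GRing.Zmodule.copy AC (A * A)%type.

Definition cscale (z : R[i]) (x : AC) : AC :=
  let: p +i* q := z in let: (a, b) := x in (p *: a - q *: b, p *: b + q *: a).

Fact cscaleA z w x : cscale z (cscale w x) = cscale (z * w) x.
Proof.
case: z w x => [p q] [p' q'] [a b] /=; congr (_, _);
  rewrite !scalerDr ?scalerN !scalerA !scalerDl ?scaleNr.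
  by rewrite [X in _ - X = _]addrC !opprD addrACA.
by rewrite [X in _ + X = _]addrC addrACA.
Qed.
Fact cscale1 : left_id 1 cscale.
Proof.
by case=> a b; rewrite /cscale /= !scale1r !scale0r subr0 addr0.
Qed.
Fact cscaleDr : right_distributive cscale +%R.
Proof.
by case=> p q [a b] [a' b'] /=; congr (_, _); rewrite !scalerDr ?opprD addrACA.
Qed.
Fact cscaleDl x : {morph cscale^~ x : z w / z + w}.
Proof.
by case: x => a b [p q] [p' q']; congr (_, _); rewrite /= !scalerDl ?opprD addrACA.
Qed.
HB.instance Definition _ :=
  GRing.Zmodule_isLmodule.Build R[i] AC cscaleA cscale1 cscaleDr cscaleDl.

Fact complexification_vect_axiom : Vector.axiom (dim A) AC.
Proof.
pose f (x : AC) : 'rV[R[i]]_(dim A) := \row_j (v2r x.1 0 j +i* v2r x.2 0 j).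
pose g (v : 'rV[R[i]]_(dim A)) : AC :=
  (r2v (map_mx (@complex.Re R) v), r2v (map_mx (@complex.Im R) v)).
exists f; last first.
  exists g => [[a b]|v].
    by congr (_, _); apply: v2r_inj; rewrite r2vK; apply/rowP => j; rewrite !mxE.
  apply/rowP => j; rewrite !mxE !r2vK !mxE.
  by case: (v _ _).
case=> p q [a b] [a' b']; apply/rowP => j; rewrite !mxE /=.
rewrite !linearD !linearN !linearZ !mxE; apply/eqP.
by rewrite eq_complex /= !mulrN !eqxx.
Qed.
HB.instance Definition _ :=
  Lmodule_hasFinDim.Build R[i] AC complexification_vect_axiom.

End Complexification.

Section Aff.
Variables (R : realType) (A : symm_alg R).
Local Notation AC := (complexification A).
Local Notation B := (sa_form A).
Local Notation "a ** b" := (sa_mul A a b) (at level 40, left associativity).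

Definition cmul (x y : AC) : AC :=
  (x.1 ** y.1 - x.2 ** y.2, x.1 ** y.2 + x.2 ** y.1).

Definition aff_form (x y : AC) : R[i] :=
  (- 4 * B x.1 y.1 - 4 * B x.2 y.2) +i* (- 4 * (B x.2 y.1 - B x.1 y.2)).

Fact cmul_bilinear : bilinear_for
  (GRing.Scale.Law.clone _ _ *:%R _) (GRing.Scale.Law.clone _ _ *:%R _) cmul.
Proof.
split=> [[a' b']|[a' b']] [p q] [a b] [c d]; congr (_, _) => /=;
  rewrite !(linearDl, linearDr, linearNl, linearNr, linearZl_LR, linearZr_LR) /=;
  rewrite !scalerDr ?scalerN ?opprD ?opprK !addrA.
- by rewrite [LHS](ACl (1*4*5*2*3*6))%AC.
- by rewrite [LHS](ACl (1*4*5*2*3*6))%AC.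
- by rewrite [LHS](ACl (1*4*2*5*3*6))%AC.
- by rewrite [LHS](ACl (1*4*2*5*3*6))%AC.
Qed.
HB.instance Definition _ :=
  bilinear_isBilinear.Build R[i] AC AC AC _ _ cmul cmul_bilinear.

Fact aff_form_bilinear : bilinear_for
  (GRing.Scale.Law.clone _ _ *%R _)
  (GRing.Scale.Law.clone _ _ (@Num.conj R[i] \; *%R) _) aff_form.
Proof.
split=> [[a' b']|[a' b']] [p q] [a b] [c d].
  apply/eqP; rewrite eq_complex /=; apply/andP; split; apply/eqP;
    rewrite !(linearDl, linearNl, linearZl_LR) /=; ring.
apply/eqP; rewrite eq_complex /=; apply/andP; split; apply/eqP;
  rewrite !(linearDr, linearNr, linearZr_LR) /=; ring.
Qed.
Fact aff_form_hermitian x y :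
  aff_form x y = (-1) ^+ false * Num.conj (aff_form y x).
Proof.
rewrite expr0 mul1r /aff_form; apply/eqP; rewrite eq_complex /=.
rewrite (hermC B x.1 y.1) (hermC B x.2 y.2) (hermC B x.1 y.2).
rewrite (hermC B x.2 y.1) !expr0 !mul1r.
by apply/andP; split; apply/eqP => /=; ring.
Qed.
HB.instance Definition _ :=
  bilinear_isBilinear.Build R[i] AC AC R[i] _ _ aff_form aff_form_bilinear.
HB.instance Definition _ :=
  isHermitianSesquilinear.Build R[i] AC _ _ aff_form aff_form_hermitian.

(* The pair corresponding to aff(A) = A + A with its standard pseudo-Kaehler
   structure (J, omega).  Under (a, b) |-> a + ib, J is multiplication by i and
   the hermitian form is - 4 omega(x, J y) + 4 i omega(x, y): see aff_JE and
   aff_formE. *)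
Definition aff_pair : herm_alg R := @HermAlg R AC cmul aff_form.

Definition aff_J (x : AC) : AC := (- x.2, x.1).

Definition aff_omega (x y : AC) : R := B x.1 y.2 - B x.2 y.1.

Lemma aff_JE x : (0 +i* 1) *: x = aff_J x.
Proof.
by case: x => a b; congr (_, _); rewrite /= !scale0r !scale1r ?sub0r ?add0r.
Qed.

Lemma aff_formE x y :
  aff_form x y = (- 4 * aff_omega x (aff_J y)) +i* (4 * aff_omega x y).
Proof.
rewrite /aff_form /aff_omega /=; congr (_ +i* _).
  by rewrite linearNr /=; ring.
by ring.
Qed.

End Aff.

(* Main.v *)
(* A non-zero isotropic vector u of ann(X) that is a common eigenvector of all
   the adjoints of multiplications exhibits X as a double extension of
   u^perp / u.  By compatibility ann(X) and its orthogonal are stable under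
   these commuting adjoints, so u exists as soon as ann(X) meets ann(X)^perp,
   and one can induct on the dimension.

   Otherwise X is the orthogonal sum of ann(X) and of V := ann(X)^perp.  By
   duality V = X X, so V has a unit e by Nakayama's lemma, and the adjoint of
   the multiplication by x is the multiplication by s(x) := R_x^* e.  Together
   with the conjugation of ann(X) in an orthogonal basis, s is an antilinear
   involutive automorphism of X, whose fixed points form the algebra A. *)
Require Import Defs.
From HB Require Import structures.
From mathcomp Require Import all_boot all_order all_algebra sesquilinear.
From mathcomp Require Import spectral complex boolp reals ring.
From Stdlib Require Import Relation_Operators.

Set Implicit Arguments.
Unset Strict Implicit.
Unset Printing Implicit Defensive.

Import Order.TTheory GRing.Theory Num.Theory.

Local Open Scope ring_scope.
Local Open Scope complex_scope.

Local Notation "x ** y" := (ha_mul _ x y) (at level 40, left associativity).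
Local Notation "''[' x , y ]" := (ha_form _ x y).

(** * Isomorphisms of algebras with a hermitian form *)

Lemma isomorphic_refl (R : realType) (X : herm_alg R) : isomorphic X X.
Proof. by exists idfun; split=> //; exists idfun. Qed.

Lemma isomorphic_sym (R : realType) (X Y : herm_alg R) :
  isomorphic X Y -> isomorphic Y X.
Proof.
case=> f [[g fK gK] fM fH].
have g_lin : linear g by apply: can2_linear fK gK.
exists (HB.pack_for {linear Y -> X} g (GRing.isLinear.Build _ _ _ _ g g_lin)).
split=> /= [|x y|x y]; first by exists f.
  by apply: (can_inj fK); rewrite fM !gK.
by rewrite -fH !gK.
Qed.

(** * Hermitian forms and the adjoints of multiplications *)

Section HermitianAlgebra.
Variables (R : realType) (X : herm_alg R).
Implicit Types x y z w : X.

Definition mul_adj z y : X := adj (ha_form X) (ha_mul X z) y.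

Lemma hform_linl a x y z : '[a *: x + y, z] = a * '[x, z] + '[y, z].
Proof. by rewrite linearDl linearZl_LR. Qed.

Lemma hform_linr a x y z : '[z, a *: x + y] = Num.conj a * '[z, x] + '[z, y].
Proof. by rewrite linearDr linearZr_LR. Qed.

Lemma hformC x y : '[x, y] = Num.conj '[y, x].
Proof. by rewrite hermC expr0 mul1r. Qed.

Lemma hform_eq0C x y : '[x, y] = 0 -> '[y, x] = 0.
Proof. by move=> xy0; rewrite hformC xy0 conjC0. Qed.

Lemma hmul_linl a x y z : (a *: x + y) ** z = a *: (x ** z) + y ** z.
Proof. by rewrite linearDl linearZl_LR. Qed.

Lemma hmul_linr a x y z : z ** (a *: x + y) = a *: (z ** x) + z ** y.
Proof. by rewrite linearDr linearZr_LR. Qed.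

(** Rank-nullity for the map pairing [x] with a basis of [W]: its kernel lies in the orthogonal of
    [W]. *)
Lemma dim_orthov_ge (W : {vspace X}) :
  (\dim {:X} <= \dim W + \dim (orthov (ha_form X) W))%N.
Proof.
pose row x := \row_(i < \dim W) '[x, (vbasis W)`_i].
have row_lin : linear (row : X -> 'rV[R[i]]_(\dim W)).
  by move=> a u v; apply/rowP => i; rewrite !mxE hform_linl.
pose rowL := HB.pack_for {linear X -> 'rV[R[i]]_(\dim W)} row
  (GRing.isLinear.Build _ _ _ _ _ row_lin).
rewrite -(limg_ker_dim (linfun rowL) fullv) capfv addnC leq_add //.
  by have := dimvS (subvf (limg (linfun rowL))); rewrite dimvf /dim /= mul1n.
apply/dimvS/subvP => x; rewrite memv_ker lfunE /= => /eqP/rowP x0.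
apply/mem_orthovP => v /coord_vbasis ->; rewrite linear_sumr big1 // => i _.
by rewrite /= linearZr_LR /=; have := x0 i; rewrite !mxE => ->; rewrite mulr0.
Qed.

Section Nondegenerate.
Hypothesis ndX : nondegenerate (ha_form X).

Lemma hform_injl x y : (forall z, '[x, z] = '[y, z]) -> x = y.
Proof. exact: nondegenerate_inj. Qed.

Lemma hform_injr x y : (forall z, '[z, x] = '[z, y]) -> x = y.
Proof. by move=> exy; apply: hform_injl => z; rewrite hformC exy -hformC. Qed.

Lemma mul_adjl z x y : '[mul_adj z x, y] = '[x, z ** y].
Proof. by rewrite /mul_adj (adjP (ha_mul X z)). Qed.

Lemma mul_adjr z x y : '[x, mul_adj z y] = '[z ** x, y].
Proof. by rewrite hformC mul_adjl -hformC. Qed.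

End Nondegenerate.

End HermitianAlgebra.

(** * Reassembling [X] as a double extension from its components [v], [Y] and [u] *)

Section Splitting.
Variables (R : realType) (X Y : herm_alg R).
Hypothesis APK_X : APK_compatible X.
Variables (j : {linear Y -> X}) (q : {linear X -> Y}) (u v : X).
Hypotheses (uv1 : '[u, v] = 1) (uu0 : '[u, u] = 0) (vv0 : '[v, v] = 0).
Hypothesis u_ann : forall x : X, u ** x = 0.
(** All adjoints of multiplications scale [u]; in particular the orthogonal of [u] is an ideal. *)
Hypothesis u_eigen : forall x y : X,
  '[x ** y, u] = '[v ** v, u] * ('[x, u] * '[y, u]).
Hypothesis j_isom : forall y z : Y, '[j y, j z] = '[y, z].
Hypothesis jK : cancel j q.
Hypothesis qK : forall x : X, j (q x) = x - '[x, v] *: u - '[x, u] *: v.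
Hypothesis mulY : forall y z : Y, y ** z = q (j y ** j z).

Let mulC : commutative (@ha_mul R X). Proof. by case: APK_X. Qed.
Let mulA : associative (@ha_mul R X). Proof. by case: APK_X. Qed.
Let ndX : nondegenerate (ha_form X). Proof. by case: APK_X. Qed.
Let compat (x y z : X) : x ** mul_adj z y = y ** mul_adj z x.
Proof. by case: APK_X => _ _ _; apply. Qed.

Let vu1 : '[v, u] = 1. Proof. by rewrite hformC uv1 conjC1. Qed.

Let ju (y : Y) : '[j y, u] = 0.
Proof.
have := congr1 (fun x => '[x, u]) (qK (j y)).
rewrite jK !linearBl !linearZl_LR /= uu0 vu1 mulr0 subr0 mulr1.
by rewrite subrr.
Qed.

Let jv (y : Y) : '[j y, v] = 0.
Proof.
have := congr1 (fun x => '[x, v]) (qK (j y)).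
rewrite jK !linearBl !linearZl_LR /= uv1 vv0 mulr0 subr0 mulr1.
by rewrite subrr.
Qed.

Let uj y : '[u, j y] = 0. Proof. exact/hform_eq0C/ju. Qed.
Let vj y : '[v, j y] = 0. Proof. exact/hform_eq0C/jv. Qed.

Let ql x y : '[q x, y] = '[x, j y].
Proof. by rewrite -j_isom qK !linearBl !linearZl_LR /= uj vj !mulr0 !subr0. Qed.

Let qr x y : '[y, q x] = '[j y, x].
Proof. by rewrite hformC ql -hformC. Qed.

Let ndY : nondegenerate (ha_form Y).
Proof.
apply/eqP/vspaceP => y; rewrite memv0; apply/mem_orthovP/eqP => [y0|-> z _].
  apply: (can_inj jK); rewrite linear0; apply: hform_injl => // x.
  by rewrite -qr y0 ?memvf // linear0l.
by rewrite linear0l.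
Qed.

Let uM x : x ** u = 0. Proof. by rewrite mulC u_ann. Qed.

(* [j (q x)] and [x] differ by [u], which annihilates, and a multiple of [v]. *)
Let jqM x z : j (q x) ** z = x ** z - '[x, u] *: (v ** z).
Proof. by rewrite qK !linearBl !linearZl_LR /= u_ann scaler0 subr0. Qed.

Let Au z x : '[mul_adj z x, u] = 0.
Proof. by rewrite mul_adjl // uM linear0r. Qed.

Let jqA z x w : j (q (mul_adj z x)) ** w = mul_adj z x ** w.
Proof. by rewrite jqM Au scale0r subr0. Qed.

(** The orthogonal of [u] is an ideal containing the image of [j], so [j y ** x] has no component
    along [v], and its component along [u] annihilates. *)
Let jqj y x z : j (q (j y ** x)) ** z = j y ** x ** z.
Proof. by rewrite jqM u_eigen ju mul0r mulr0 scale0r subr0. Qed.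

Let adjY z y : adj (ha_form Y) (ha_mul Y z) y = q (mul_adj (j z) (j y)).
Proof.
apply: (@adj_unique _ _ _ _ (fun y => q (mul_adj (j z) (j y)))) => // {}y w.
by rewrite ql mul_adjl // mulY qr.
Qed.

Let APK_Y : APK_compatible Y.
Proof.
split=> // [y z|x y z|x y z]; first by rewrite !mulY mulC.
  by rewrite !mulY jqj [j x ** _]mulC jqj mulC mulA.
by rewrite !adjY !mulY mulC jqA [in RHS]mulC jqA mulC compat mulC.
Qed.


Let D (y : Y) : Y := q (v ** j y).
Let D_linear : linear D.
Proof. by move=> a y z; rewrite /D !linearP. Qed.
HB.instance Definition _ := GRing.isLinear.Build _ _ _ _ D D_linear.

(** Chosen so that ['[z, tau y]] is the form of [j y ** j z] with [v], which is the coefficient of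
    [u] in this product. *)
Let tau (y : Y) : Y := q (mul_adj (j y) v).
Let tau_semilinear : linear_for (@Num.conj R[i] \; *:%R) tau.
Proof.
move=> a y z; apply: hform_injr => // w; rewrite qr mul_adjr // linearP.
by rewrite hmul_linl hform_linl linearDr linearZr_LR /= !qr !mul_adjr ?conjCK.
Qed.
HB.instance Definition _ := GRing.isLinear.Build _ _ _ _ tau tau_semilinear.

(** Pairing with [u] reads off the coefficient of [v], and pairing with [v] that of [u]. So the data
    are the coordinates of [v ** v], while $b_0$ represents the coefficient of [u] in [v ** j z]. *)
Let dd : dext_data Y := DextData '[v ** v, u] '[v ** v, v] (q (v ** v))
  (q (mul_adj v v)) D tau.

Let form_tau y z : '[z, tau y] = '[j y ** j z, v].
Proof. by rewrite qr mul_adjr. Qed.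
Let form_b0 z : '[z, q (mul_adj v v)] = '[v ** j z, v].
Proof. by rewrite qr mul_adjr. Qed.

Let adjD y : adj (ha_form Y) D y = q (mul_adj v (j y)).
Proof.
apply: (@adj_unique _ _ _ _ (fun y => q (mul_adj v (j y)))) => // {}y w.
by rewrite ql mul_adjl // qr.
Qed.

Let dd_axioms : dext_axioms dd.
Proof.
(* [v ** v] may have a component along [v]; removing it produces the terms in [de_eps]. *)
have vvM x : j (q (v ** v)) ** x = v ** v ** x - '[v ** v, u] *: (v ** x).
  exact: jqM.
have vjq y x : v ** j (q (j y ** x)) = v ** (j y ** x) by rewrite mulC jqj mulC.
have vqv y : v ** j (q (v ** j y)) = v ** (v ** j y).
  by rewrite mulC jqM u_eigen ju !mulr0 scale0r subr0 mulC.
have MjqA w x z : w ** j (q (mul_adj z x)) = w ** mul_adj z x.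
  by rewrite mulC jqA mulC.
have Mqv y z : j (q (v ** j y)) ** z = v ** j y ** z.
  by rewrite jqM u_eigen ju !mulr0 scale0r subr0.
have form_adjR x y w : '[w, adj (ha_form Y) (ha_mul Y x) y] = '[x ** w, y].
  by rewrite hformC (adjP (ha_mul Y x)) // -hformC.
(* Compatibility paired with [v]: the vector under the adjoint trades places with the other
   factor. *)
have adj2 x y w : '[mul_adj x y ** w, v] = '[mul_adj x w ** y, v].
  by rewrite mulC compat mulC.
have form_adjD_b0 y :
    '[y, adj (ha_form Y) D (q (mul_adj v v))] = '[v ** (v ** j y), v].
  by rewrite adjD qr mul_adjr // -ql form_b0 vqv.
split=> /=.
- by move=> x y; rewrite !mulY /D Mqv vjq mulA.
- by move=> x; rewrite mulY /D vqv vvM -linearZ -linearB mulA.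
- by move=> x y; rewrite form_tau -hformC form_tau mulC.
- apply: hform_injr => // y; rewrite form_tau vvM linearBr linearZr_LR /=.
  by rewrite form_adjD_b0 conjCK form_b0 linearBl linearZl_LR /= mulA.
- move=> x; apply: hform_injr => // y; rewrite form_tau /tau jqA.
  rewrite mulC compat mulC [mul_adj _ _ ** _]mulC -mul_adjr //.
  by rewrite mul_adjl // mulY qr jqA mulC.
- by move=> x; rewrite adjD /D MjqA mulY jqA compat mulC.
- apply: hform_injr => // y; rewrite form_tau jqA adj2 mulC -mul_adjr //.
  by rewrite mul_adjl // /D MjqA qr.
- move=> x y; apply: hform_injr => // w; rewrite adjY form_tau jqA adj2.
  by rewrite mulC -mul_adjr // mul_adjl // mulY /tau qr MjqA.
- move=> x y; apply: hform_injr => // w; rewrite form_adjR !form_tau !mulY.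
  by rewrite jqj [j y ** _]mulC jqj -!mulA [j y ** _]mulC.
- move=> x; apply: hform_injr => // w; rewrite adjD form_tau jqA adj2.
  by rewrite mulC -mul_adjr // mul_adjl // /D MjqA qr.
- by move=> x y; rewrite adjY /D /tau MjqA mulY jqA compat mulC.
- move=> x; apply: hform_injr => // w; rewrite form_adjR form_tau form_b0.
  by rewrite /D Mqv mulY vjq mulA.
Qed.

Let qu : q u = 0.
Proof.
by apply: (can_inj jK); rewrite qK uv1 uu0 scale0r scale1r subr0 subrr linear0.
Qed.

Let qv : q v = 0.
Proof.
by apply: (can_inj jK); rewrite qK vu1 vv0 scale0r scale1r subr0 subrr linear0.
Qed.

Let f (x : X) : dext dd := ('[x, u], q x, '[x, v]).
Let f_linear : linear f.
Proof. by move=> a x y; rewrite /f !hform_linl linearP. Qed.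
HB.instance Definition _ := GRing.isLinear.Build _ _ _ _ f f_linear.

Let f_decomp x : x = '[x, u] *: v + j (q x) + '[x, v] *: u.
Proof. by rewrite qK [_ *: v + _]addrC !subrK. Qed.

(** [Y] is tied to [X] by the maps [j] and [q] and not as a subspace, so that any pair isomorphic to
    $u^\bot/u$ can serve. *)
Lemma APK_double_extension_of_splitting : APK_double_extension Y X.
Proof.
split=> //; exists dd; split=> //; exists f; split.
- exists (fun p : dext dd => p.1.1 *: v + j p.1.2 + p.2 *: u) => [x|[[s y] t]].
    exact/esym/f_decomp.
  rewrite /= /f !linearDl !linearZl_LR /= !linearD !linearZ /= jK qu qv uu0.
  by rewrite vu1 uv1 vv0 ju jv !mulr0 !scaler0 !mulr1 !addr0 !add0r.
- move=> x y; rewrite /= /f u_eigen /=.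
  have xyE : x ** y
    = ('[x, u] * '[y, u]) *: (v ** v) + '[x, u] *: (v ** j (q y))
      + '[y, u] *: (v ** j (q x)) + j (q x) ** j (q y).
    rewrite [in LHS](f_decomp x) [in LHS](f_decomp y).
    rewrite !(linearDl, linearDr, linearZl_LR, linearZr_LR) /= !u_ann !uM.
    rewrite !scaler0 !addr0 scalerA -!addrA [j _ ** v]mulC.
    by congr (_ + _).
  congr (_, _, _); first by rewrite mulrC.
    by rewrite xyE !linearD !linearZ /= mulY.
  rewrite xyE !linearDl !linearZl_LR /= !form_b0 form_tau mulC.
  by rewrite [j (q x) ** _]mulC.
- move=> x y; rewrite [in RHS](f_decomp x) [in RHS](f_decomp y) /f /=.
  rewrite !(linearDl, linearDr, linearZl_LR, linearZr_LR) /=.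
  rewrite !(uu0, vv0, uv1, vu1, uj, vj, ju, jv, j_isom).
  rewrite !(mulr0, mulr1, addr0, add0r).
  by rewrite addrAC [LHS]addrC addrA addrAC.
Qed.

End Splitting.

(** * Stability and common eigenvectors for the adjoints of multiplications *)

Section MulAdj.
Variables (R : realType) (X : herm_alg R).
Hypothesis APK_X : APK_compatible X.
Implicit Types x y z w : X.

Let mulC : commutative (@ha_mul R X). Proof. by case: APK_X. Qed.
Let mulA : associative (@ha_mul R X). Proof. by case: APK_X. Qed.
Let ndX : nondegenerate (ha_form X). Proof. by case: APK_X. Qed.
Let compat x y z : x ** mul_adj z y = y ** mul_adj z x.
Proof. by case: APK_X => _ _ _; apply. Qed.

Lemma mul_adj_linear z : linear (mul_adj z).
Proof.
move=> a x y; apply: hform_injl => // w.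
by rewrite mul_adjl // !hform_linl !mul_adjl.
Qed.

Lemma mul_adj_semilinear x :
  linear_for (@Num.conj R[i] \; *:%R) (@mul_adj R X ^~ x).
Proof.
move=> a y z; apply: hform_injr => // w.
rewrite mul_adjr // hmul_linl hform_linl linearDr linearZr_LR /= conjCK.
by rewrite !mul_adjr.
Qed.

Lemma mul_adj_comm x y z : mul_adj x (mul_adj y z) = mul_adj y (mul_adj x z).
Proof.
apply: hform_injl => // w; rewrite !mul_adjl // mulA.
by rewrite [y ** x]mulC mulA.
Qed.

Lemma mul_adj_orth_ann z y : mul_adj z y \in orthov (ha_form X) (ann X).
Proof.
apply/mem_orthovP => w /annP w0.
by rewrite mul_adjl // mulC w0 linear0r.
Qed.

(** Compatibility gives [w ** mul_adj z y = y ** mul_adj z w], a product with the annihilating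
    [y]. *)
Lemma mul_adj_ann z y : y \in ann X -> mul_adj z y \in ann X.
Proof. by move=> /annP y0; apply/annP => w; rewrite mulC compat y0. Qed.

(** Commuting endomorphisms of a non-zero complex space share an eigenvector. Finitely many suffice,
    with [z] in a basis of [X], because [mul_adj z u] is semilinear in [z]. *)
Lemma mul_adj_common_eigenvector (K : {vspace X}) :
  K != 0%VS -> (forall z y, y \in K -> mul_adj z y \in K) ->
  exists u, [/\ u != 0, u \in K & forall z, mul_adj z u \in <[u]>%VS].
Proof.
move=> K0 stabK; pose b := vbasis K; pose n := \dim K.
pose r (t : 'rV[R[i]]_n) : X := \sum_i t 0 i *: b`_i.
have rK t : r t \in K.
  apply: rpred_sum => i _; apply: rpredZ.
  by apply/vbasis_mem/mem_nth; rewrite size_tuple.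
have bK (i : 'I_n) : b`_i \in K by apply/vbasis_mem/mem_nth; rewrite size_tuple.
have r_inj : injective r.
  move=> t s rts; apply/rowP => i.
  have /(congr1 (coord b i)) := rts; rewrite !coord_sum_free //;
  exact: basis_free (vbasisP K).
pose M z : 'M[R[i]]_n := \matrix_(i, k) coord b k (mul_adj z b`_i).
have A0 z : mul_adj z 0 = 0.
  by have := mul_adj_linear z (-1) 0 0; rewrite scaler0 addr0 scaleN1r addNr.
have rM t z : r (t *m M z) = mul_adj z (r t).
  transitivity (\sum_i t 0 i *: mul_adj z b`_i).
    rewrite /r; under eq_bigr do rewrite !mxE scaler_suml.
    rewrite exchange_big /=; apply: eq_bigr => i _.
    rewrite [in RHS](coord_vbasis (stabK z _ (bK i))) scaler_sumr.
    by apply: eq_bigr => k _; rewrite mxE scalerA.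
  rewrite /r; apply: (big_rec2 (fun x y => x = mul_adj z y)) => [|i x y _ ->].
    by rewrite A0.
  by rewrite mul_adj_linear.
have Mcomm z w : M z *m M w = M w *m M z.
  apply/row_matrixP => i; rewrite !rowE !mulmxA; apply: r_inj.
  by rewrite !rM mul_adj_comm.
have n0 : (n > 0)%N by rewrite lt0n dimv_eq0.
pose e := vbasis {:X}.
have [|t t0 /allP tP] := @common_eigenvector _ _ [seq M z | z <- e] n0.
  by move=> _ _ /mapP[z _ ->] /mapP[w _ ->]; exact: Mcomm.
exists (r t); split=> // [|z].
  apply: contra_neq t0 => r0; apply: r_inj; rewrite r0 /r big1 // => i _.
  by rewrite mxE scale0r.
rewrite (coord_vbasis (memvf z)).
apply: (big_ind (fun z => mul_adj z (r t) \in <[r t]>%VS)) => [|x y xt yt|i _].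
- have := mul_adj_semilinear (r t) (-1) 0 0.
  by rewrite scaler0 addr0 /= rmorphN1 scaleN1r addNr => ->; exact: mem0v.
- have := mul_adj_semilinear (r t) 1 x y.
  by rewrite scale1r /= rmorph1 scale1r => ->; exact: rpredD.
- have := mul_adj_semilinear (r t) (coord e i z) e`_i 0.
  have -> : mul_adj 0 (r t) = 0.
    have := mul_adj_semilinear (r t) (-1) 0 0.
    by rewrite scaler0 addr0 /= rmorphN1 scaleN1r addNr.
  rewrite !addr0 /= => ->; apply: rpredZ.
  have /tP : M e`_i \in [seq M z | z <- e].
    by apply/map_f/mem_nth; rewrite size_tuple.
  move=> /sub_rVP[a ta]; apply/vlineP; exists a.
  rewrite -rM ta /r scaler_sumr; apply: eq_bigr => k _.
  by rewrite mxE scalerA.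
Qed.

End MulAdj.

(** * Product and form induced on a space by two linear maps *)

Section Pullback.
Variables (R : realType) (X : herm_alg R) (S : vectType R[i]).
Variables (j : {linear S -> X}) (q : {linear X -> S}).

Definition pull_mul (y z : S) : S := q (j y ** j z).
Definition pull_form (y z : S) : R[i] := '[j y, j z].

Fact pull_mul_bilinear : bilinear_for
  (GRing.Scale.Law.clone _ _ *:%R _) (GRing.Scale.Law.clone _ _ *:%R _)
  pull_mul.
Proof.
split=> [z|z] a x y; rewrite /pull_mul linearP.
  by rewrite hmul_linl linearP.
by rewrite hmul_linr linearP.
Qed.
HB.instance Definition _ :=
  bilinear_isBilinear.Build _ _ _ _ _ _ pull_mul pull_mul_bilinear.

Fact pull_form_bilinear : bilinear_for
  (GRing.Scale.Law.clone _ _ *%R _)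
  (GRing.Scale.Law.clone _ _ (@Num.conj R[i] \; *%R) _) pull_form.
Proof.
split=> [z|z] a x y; rewrite /pull_form linearP; first exact: hform_linl.
exact: hform_linr.
Qed.
Fact pull_form_hermitian x y :
  pull_form x y = (-1) ^+ false * Num.conj (pull_form y x).
Proof. exact: hermC. Qed.
HB.instance Definition _ :=
  bilinear_isBilinear.Build _ _ _ _ _ _ pull_form pull_form_bilinear.
HB.instance Definition _ :=
  isHermitianSesquilinear.Build _ _ _ _ pull_form pull_form_hermitian.

(** With [S] the orthogonal of [u] and [v], and [q] the projection onto it, this models $u^\bot/u$
    without forming a quotient. *)
Definition pullback : herm_alg R := HermAlg pull_mul pull_form.

End Pullback.

(** * One double extension step when [ann X] is degenerate *)

Section AnnIsotropic.
Variables (R : realType) (X : herm_alg R).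
Hypothesis APK_X : APK_compatible X.

Let ndX : nondegenerate (ha_form X). Proof. by case: APK_X. Qed.

(** Non-degeneracy gives some [v] with ['[u, v] = 1]. As [u] is isotropic, subtracting a multiple of
    [u] keeps this pairing, and the real number ['[v, v]] is cancelled by the multiple ['[v, v] /
    2]. *)
Lemma isotropic_dual (u : X) : u != 0 -> '[u, u] = 0 ->
  exists v : X, '[u, v] = 1 /\ '[v, v] = 0.
Proof.
move=> u0 uu0.
have /mem_orthovPn[w _ uw0] : u \notin orthov (ha_form X) fullv.
  by rewrite (eqP ndX) memv0.
have [v uv1] : exists v : X, '[u, v] = 1.
  by exists (Num.conj '[u, w]^-1 *: w); rewrite linearZr_LR /= conjCK mulVf.
have vu1 : '[v, u] = 1 by rewrite hformC uv1 conjC1.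
exists (v - ('[v, v] / 2) *: u); split.
  by rewrite linearBr linearZr_LR /= uu0 mulr0 subr0.
rewrite !(linearBl, linearBr, linearZl_LR, linearZr_LR) /=.
rewrite uu0 uv1 vu1 !mulr0 subr0 !mulr1 rmorphM /= -hformC fmorphV /= conjC_nat.
by rewrite -addrA -opprD -splitr subrr.
Qed.

(** The drop in dimension and the quantification over [Z] serve the induction, where [Y] may have to
    be replaced by an isomorphic pair. *)
Lemma double_extension_of_ann_isotropic :
  (ann X :&: orthov (ha_form X) (ann X))%VS != 0%VS ->
  exists Y : herm_alg R, [/\ APK_compatible Y, (\dim {:Y} < \dim {:X})%N &
    forall Z, isomorphic Y Z -> APK_double_extension Z X].
Proof.
have [mulC mulA _ _] := APK_X => K0.
have [z y|u [u0 uK u_eig]] := mul_adj_common_eigenvector APK_X K0.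
  by rewrite !memv_cap => /andP[yA _]; rewrite mul_adj_ann // mul_adj_orth_ann.
have [/annP u_ann uu0] : u \in ann X /\ '[u, u] = 0.
  move: uK; rewrite memv_cap => /andP[uA /mem_orthovP uo].
  by split; last exact: uo.
have [v [uv1 vv0]] := isotropic_dual u0 uu0.
have vu1 : '[v, u] = 1 by rewrite hformC uv1 conjC1.
have u_eigen (x y : X) :
    '[x ** y, u] = '[v ** v, u] * ('[x, u] * '[y, u]).
  (* The adjoint of the multiplication by [z] scales [u], and pairing with [v] finds the factor. By
     commutativity this applies to both arguments, which leaves only the square of [v]. *)
  have lin (z w : X) : '[z ** w, u] = '[z ** v, u] * '[w, u].
    have /vlineP[a za] := u_eig z.
    by rewrite -!mul_adjr // za !linearZr_LR /= vu1 mulr1.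
  by rewrite lin mulC lin mulrA.
pose W := orthov (ha_form X) (<[u]> + <[v]>)%VS.
have WP x : reflect ('[x, u] = 0 /\ '[x, v] = 0) (x \in W).
  rewrite /W memvE orthovD -!memvE !mem_orthov1.
  by apply: (iffP andP) => -[]; [move=> /eqP-> /eqP-> | move=> -> ->].
pose p x : X := x - '[x, v] *: u - '[x, u] *: v.
have pW x : p x \in W.
  apply/WP; rewrite /p !linearBl !linearZl_LR /= uu0 vu1 uv1 vv0.
  by rewrite !mulr0 !mulr1 !subr0 !subrr.
have pid x : x \in W -> p x = x.
  by move=> /WP[xu xv]; rewrite /p xu xv !scale0r !subr0.
have p_lin : linear p.
  move=> a x y; rewrite /p !hform_linl !scalerBr !scalerDl !scalerA.
  by rewrite !opprD !addrA [LHS](ACl (1*3*5*2*4*6))%AC.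
pose P := HB.pack_for {linear X -> X} p (GRing.isLinear.Build _ _ _ _ p p_lin).
have [q [j [jK qK]]] : exists (q : {linear X -> subvs_of W})
    (j : {linear subvs_of W -> X}), cancel j q /\ forall x, j (q x) = p x.
  exists (vsproj W \o P), vsval; split=> [y|x] /=; last by rewrite vsprojK.
  by rewrite pid ?subvsP // vsvalK.
pose Y := pullback j q.
have ext Z : isomorphic Y Z -> APK_double_extension Z X.
  case=> f [[g fK gK] fM fH].
  have g_lin : linear g by apply: can2_linear fK gK.
  pose gL := HB.pack_for {linear Z -> Y} g
    (GRing.isLinear.Build _ _ _ _ g g_lin).
  apply: (@APK_double_extension_of_splitting _ X Z APK_X (j \o gL) (f \o q) u v)
    => //= [y z|y|x|y z].
  - by rewrite -[LHS]/(ha_form Y _ _) -fH !gK.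
  - by rewrite /= jK gK.
  - by rewrite fK qK.
  - by rewrite -[y in LHS]gK -[z in LHS]gK -fM.
exists Y; split=> //.
  have [] // : APK_double_extension Y X.
  exact/ext/isomorphic_refl.
have -> : \dim {:Y} = \dim W by rewrite dimvf.
(* The dimension drops because [u] is outside [W]: it pairs to 1 with [v]. *)
rewrite ltnNge; apply/negP => dW.
have /eqP WX : W == fullv by rewrite eqEdim subvf.
have /WP[_ /eqP] : u \in W by rewrite WX memvf.
by rewrite uv1 oner_eq0.
Qed.

End AnnIsotropic.

(** * Nakayama's lemma in an algebra without unit *)

Section Nakayama.
Variables (R : realType) (X : herm_alg R).
Hypotheses (mulC : commutative (@ha_mul R X))
  (mulA : associative (@ha_mul R X)).

(* The coefficients are in [X], which has no unit: an entry of [s] need not be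
   such a combination. *)
Fixpoint ideal_comb (s : seq X) (x : X) : Prop :=
  if s is v :: s' then exists a, ideal_comb s' (x - a ** v) else x = 0.

Lemma ideal_comb_lin s c x y :
  ideal_comb s x -> ideal_comb s y -> ideal_comb s (c *: x + y).
Proof.
elim: s x y => [|v s IHs] x y /= => [->->|[a xa] [b yb]].
  by rewrite scaler0 addr0.
exists (c *: a + b); rewrite hmul_linl opprD addrACA -scalerBr.
exact: IHs.
Qed.

Lemma ideal_comb_mul s c x : ideal_comb s x -> ideal_comb s (c ** x).
Proof.
elim: s x => [|v s IHs] x /= => [->|[a xa]]; first by rewrite linear0r.
by exists (c ** a); rewrite -mulA -linearBr; exact: IHs.
Qed.

Lemma ideal_comb0 s : ideal_comb s 0.
Proof. by elim: s => // v s IHs; exists 0; rewrite linear0l subr0. Qed.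

Lemma mem_ideal_comb s a v : v \in s -> ideal_comb s (a ** v).
Proof.
elim: s => // w s IHs; rewrite inE => /orP[/eqP->|vs].
  by exists a; rewrite subrr; exact: ideal_comb0.
by exists 0; rewrite linear0l subr0; exact: IHs.
Qed.

(* The generators are eliminated one at a time,
   replacing [1 - e] by [(1 - e - a) (1 - e)]. *)
Lemma nakayama s : (forall x, x \in s -> ideal_comb s x) ->
  exists e, forall x, x \in s -> e ** x = x.
Proof.
move=> ss.
(* Invariant: $(1-e)x$ is a combination of the remaining generators [t]. It starts with [e = 0] and
   [t = s]; for empty [t] it reads [x = e ** x]. *)
suff elim_gen t e : {subset t <= s} ->
    (forall x, x \in s -> ideal_comb t (x - e ** x)) ->
    exists e', forall x, x \in s -> e' ** x = x.
  by apply: (elim_gen s 0) => // x xs; rewrite linear0l subr0; exact: ss.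
elim: t e => [|v t IHt] e ts es /=.
  by exists e => x /es /= /eqP; rewrite subr_eq0 => /eqP.
have [a va] : exists a, ideal_comb t (v - e ** v - a ** v).
  by apply: es; apply: ts; rewrite mem_head.
set f := e + a; apply: (IHt (e + f - e ** f)) => [x xt|x xs].
  by apply: ts; rewrite in_cons xt orbT.
have [b] := es x xs; set m := x - e ** x => xb.
have fE y : y - f ** y = y - e ** y - a ** y by rewrite linearDl opprD addrA.
(* This is $(1-f)y=(1-f)(y-cv)+c(1-f)v$. For [y = m] and [c = b] both parts are combinations of [t],
   the second by the choice of [a]. *)
have split_gen y c : y - f ** y
    = (y - c ** v - f ** (y - c ** v)) + c ** (v - f ** v).
  rewrite !linearBr /= !mulA [c ** f]mulC opprB !addrA.
  by rewrite [RHS](ACl (1*4*2*5*3*6))%AC /= subrK addrK.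
have -> : x - (e + f - e ** f) ** x = m - f ** m.
  rewrite /m linearBr linearBl linearDl /= [f ** (e ** x)]mulA [f ** e]mulC.
  by rewrite !opprB opprD !addrA [x + _ - _]addrAC.
rewrite (split_gen m b) [v - _]fE addrC -[b ** _]scale1r; apply: ideal_comb_lin.
  exact: ideal_comb_mul.
rewrite addrC -[- (f ** _)]scaleN1r; apply: ideal_comb_lin => //.
exact: ideal_comb_mul.
Qed.

End Nakayama.

(** Induction on the dimension: split off an anisotropic [w], conjugate the coordinate along it, and
    recurse on its orthogonal in [W]. The last identity forces [s] to vanish on the orthogonal of
    [W]. *)
Lemma orthogonal_conjugation (R : realType) (X : herm_alg R) (W : {vspace X}) :
  (W :&: orthov (ha_form X) W = 0)%VS ->
  exists s : X -> X, [/\ linear_for (@Num.conj R[i] \; *:%R) s,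
        forall x, s x \in W, forall x, x \in W -> s (s x) = x &
        forall x y, '[s x, y] = '[s y, x]].
Proof.
have [n] := ubnP (\dim W); elim: n W => // n IHn W; rewrite ltnS => dW W0.
have [->|WN0] := eqVneq W 0%VS.
  exists (fun=> 0); split=> [a x y|x|x|x y] /=; rewrite ?mem0v ?linear0l //.
    by rewrite scaler0 addr0.
  by rewrite memv0 => /eqP.
(* If all vectors of [W] were isotropic, polarization with [y] and ['i *: y] would put [W] inside
   its own orthogonal. *)
have [w wW ww0] : exists2 w, w \in W & '[w, w] != 0.
  apply: contrapT => noW.
  have Wiso w : w \in W -> '[w, w] = 0.
    by move=> wW; apply/eqP/negP => /negP ww; apply: noW; exists w.
  have re0 x y : x \in W -> y \in W -> '[x, y] + '[y, x] = 0.
    move=> xW yW; have := Wiso _ (rpredD xW yW).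
    by rewrite linearDl !linearDr /= !Wiso // add0r addr0.
  move/negP: WN0; apply; rewrite -subv0 -W0 subv_cap subvv /=.
  apply/subvP => x xW; apply/mem_orthovP => y yW.
  have := re0 _ _ xW (rpredZ 'i yW); have := re0 _ _ xW yW.
  rewrite linearZr_LR linearZl_LR /= conjCi => /eqP.
  rewrite addr_eq0 => /eqP ->; rewrite mulNr mulrN opprK -mulrDr => /eqP.
  rewrite mulf_eq0 (negPf (neq0Ci _)) /= -mulr2n mulrn_eq0 => /eqP ->.
  by rewrite oppr0.
pose W' := (W :&: orthov (ha_form X) <[w]>)%VS.
have W'P x : reflect (x \in W /\ '[x, w] = 0) (x \in W').
  rewrite /W' memv_cap mem_orthov1.
  by apply: (iffP andP) => -[xW /eqP xw].
have split_w x : x \in W -> x - ('[x, w] / '[w, w]) *: w \in W'.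
  move=> xW; apply/W'P; rewrite rpredB ?rpredZ //; split=> //.
  by rewrite linearBl linearZl_LR /= divfK // subrr.
have [||s [s_lin sW' sK sC]] := IHn W'.
- apply: leq_trans dW; rewrite ltnNge; apply/negP => dW'.
  have /eqP W'E : W' == W by rewrite eqEdim capvSl.
  have /W'P[_ /eqP] : w \in W' by rewrite W'E.
  by rewrite (negPf ww0).
- apply/eqP; rewrite -subv0; apply/subvP => x.
  rewrite memv_cap memv0 => /andP[xW' /mem_orthovP xo].
  have /W'P[xW xw] := xW'.
  rewrite -memv0 -W0 memv_cap xW /=; apply/mem_orthovP => y yW.
  rewrite -[y](subrK (('[y, w] / '[w, w]) *: w)) linearDr linearZr_LR /= xw.
  by rewrite mulr0 addr0 xo ?split_w.
have ww : Num.conj '[w, w] = '[w, w] by rewrite -hformC.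
(* ['[s w, y] = '[s y, w]] is zero because [s y] lies in [W'], and [W] has no radical. *)
have sw : s w = 0.
  apply/eqP; rewrite -memv0 -W0 memv_cap.
  have /W'P[-> _] := sW' w; apply/mem_orthovP => y _.
  by rewrite sC; have /W'P[] := sW' y.
(* Since ['[w, w]] is real, the added coefficient is the conjugate of the coordinate ['[x, w] /
   '[w, w]]. *)
exists (fun x => s x + ('[w, x] / '[w, w]) *: w).
split=> [a x y|x|x xW|x y] /=.
- rewrite s_lin /= scalerDr scalerA addrACA -scalerDl; congr (_ + _ *: _).
  by rewrite hform_linr mulrDl mulrA.
- by rewrite rpredD ?rpredZ //; have /W'P[] := sW' x.
- have s_addw a y : s (y + a *: w) = s y.
    by rewrite addrC s_lin sw /= scaler0 add0r.
  have x'W := split_w x xW; set c := '[x, w] / _ in x'W.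
  have /W'P[_ sxw] := sW' x.
  rewrite s_addw linearDr linearZr_LR /= (hform_eq0C sxw) add0r mulfK //.
  rewrite rmorphM /= -hformC fmorphV /= ww -/c.
  by rewrite -[in s x](subrK (c *: w) x) s_addw sK // subrK.
- rewrite !linearDl !linearZl_LR /= sC; congr (_ + _).
  by rewrite mulrAC ['[w, x] * _]mulrC mulrAC.
Qed.

(** * The conjugation when [ann X] meets its orthogonal trivially *)

Section AnnNondegenerate.
Variables (R : realType) (X : herm_alg R).
Hypothesis APK_X : APK_compatible X.
Hypothesis ann0 : (ann X :&: orthov (ha_form X) (ann X) = 0)%VS.
Implicit Types x y z w : X.

Local Notation V := (orthov (ha_form X) (ann X)).

Let mulC : commutative (@ha_mul R X). Proof. by case: APK_X. Qed.
Let mulA : associative (@ha_mul R X). Proof. by case: APK_X. Qed.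
Let ndX : nondegenerate (ha_form X). Proof. by case: APK_X. Qed.
Let compat x y z : x ** mul_adj z y = y ** mul_adj z x.
Proof. by case: APK_X => _ _ _; apply. Qed.

Let cap0 x : x \in ann X -> x \in V -> x = 0.
Proof. by move=> xA xV; apply/eqP; rewrite -memv0 -ann0 memv_cap xA. Qed.

(** ['[x ** y, a]] equals ['[y, mul_adj x a]], and for [a] in [ann X] the vector [mul_adj x a] lies
    in both [ann X] and [V]. *)
Let mulV x y : x ** y \in V.
Proof.
apply/mem_orthovP => a aA; rewrite -mul_adjr //.
by rewrite (cap0 (mul_adj_ann APK_X x aA)) ?mul_adj_orth_ann // linear0r.
Qed.

Let annD x : exists a v, [/\ a \in ann X, v \in V & x = a + v].
Proof.
have /eqP dimAV : (\dim (ann X + V) == \dim (ann X) + \dim V)%N.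
  by rewrite (dimv_disjoint_sum ann0).
have /eqP AV : (ann X + V == fullv)%VS.
  by rewrite eqEdim subvf dimAV dim_orthov_ge.
have /memv_addP[a aA [v vV ->]] : x \in (ann X + V)%VS by rewrite AV memvf.
by exists a, v.
Qed.

(** Every [mul_adj x z] vanishes, so by compatibility [z] kills the images of all adjoints. Dually
    the image of [mul_adj z] lies in [ann X]; as it also lies in [V], it is zero, and so is
    multiplication by [z]. *)
Let ann_of_orth_mul z : (forall x y, '[z, x ** y] = 0) -> z \in ann X.
Proof.
move=> z0.
have Az0 x : mul_adj x z = 0.
  by apply: hform_injl => // y; rewrite mul_adjl // z0 linear0l.
have zA x y : z ** mul_adj x y = 0 by rewrite compat Az0 linear0r.
have Az x : mul_adj z x = 0.
  apply: cap0; last exact: mul_adj_orth_ann.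
  apply/annP => y; apply: hform_injr => // w; rewrite linear0r.
  by rewrite mulC -mul_adjl // mul_adjr // zA linear0l.
apply/annP => y; apply: hform_injr => // w.
by rewrite linear0r -mul_adjl // -[X in '[X, _]]/(mul_adj z w) Az linear0l.
Qed.

Let products := [seq x ** y | x <- vbasis {:X}, y <- vbasis {:X}].
Let S : {vspace X} := <<products>>%VS.

Let mulS x y : x ** y \in S.
Proof.
rewrite (coord_vbasis (memvf x)) linear_sumlz rpred_sum // => i _.
rewrite linearZl_LR rpredZ // (coord_vbasis (memvf y)) linear_sumr rpred_sum //.
move=> k _; rewrite linearZr_LR rpredZ //; apply: memv_span.
by apply: allpairs_f; apply: mem_nth; rewrite size_tuple.
Qed.

(** Dimension count: [S] is inside [V], its orthogonal is inside [ann X], and the dimensions of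
    [ann X] and [V] sum to at most that of [X]. *)
Let sub_VS : (V <= S)%VS.
Proof.
have SV : (S <= V)%VS.
  by apply/span_subvP => _ /allpairsP[[x y] [_ _ ->]]; exact: mulV.
have oS : (orthov (ha_form X) S <= ann X)%VS.
  apply/subvP => z /mem_orthovP zS; apply: ann_of_orth_mul => x y.
  exact/zS/mulS.
rewrite -(geq_leqif (dimv_leqif_sup SV)).
have := dim_orthov_ge S; have := dimvS oS.
have := dimvS (subvf (ann X + V)); rewrite dimv_disjoint_sum //.
by move=> AV SA XS; rewrite -(leq_add2r (\dim (ann X))) addnC
  (leq_trans AV) // (leq_trans XS) // leq_add2l.
Qed.

(** Vectors of [V] are sums of products, in which the annihilator part of a factor drops out. So
    each basis vector of [V] is a combination of the basis with coefficients in [X], and Nakayama's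
    lemma applies. *)
Let unitV : exists e, forall x, x \in V -> e ** x = x.
Proof.
have [|e eb] := @nakayama _ _ mulC mulA (vbasis V); last first.
  exists e => x /coord_vbasis ->; rewrite linear_sumr; apply: eq_bigr => i _.
  by rewrite linearZr_LR eb // mem_nth ?size_tuple.
move=> b /vbasis_mem bV; have := subvP sub_VS _ bV.
pose good x := ideal_comb (vbasis V) x.
have goodD x y : good x -> good y -> good (x + y).
  by move=> gx gy; rewrite -[x]scale1r; exact: ideal_comb_lin.
have goodZ c x : good x -> good (c *: x).
  move=> gx; rewrite -[_ *: _]addr0; apply: ideal_comb_lin => //.
  exact: ideal_comb0.
have good_sum (n : nat) (F : 'I_n -> X) :
    (forall i, good (F i)) -> good (\sum_i F i).
  by move=> gF; apply: big_ind => [|x y|i _];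
    [exact: ideal_comb0|exact: goodD|exact: gF].
have goodM x y : good (x ** y).
  have [a [v [/annP a0 vV ->]]] := annD y.
  rewrite linearDr /= [x ** a]mulC a0 add0r (coord_vbasis vV) linear_sumr.
  apply: good_sum => i; rewrite linearZr_LR; apply: goodZ.
  by apply: mem_ideal_comb; rewrite mem_nth ?size_tuple.
move=> bS; rewrite -/(good b) (@coord_span _ _ _ (in_tuple products) _ bS).
apply: good_sum => i.
apply: goodZ; have : (in_tuple products)`_i \in products by rewrite mem_nth.
by move=> /allpairsP[[x y] [_ _ ->]].
Qed.

Lemma ann_nondegenerate_conjugation : exists s : X -> X,
  [/\ linear_for (@Num.conj R[i] \; *:%R) s, involutive s,
      forall x y, s (x ** y) = s x ** s y,
      forall x y, '[s x, y] = '[s y, x] &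
      forall x y z, '[x ** y, z] = '[x, s y ** z]].
Proof.
have [e eV] := unitV.
have [sN [sN_lin sNA sNK sNC]] := orthogonal_conjugation ann0.
pose sV x := mul_adj x e.
have sV_lin : linear_for (@Num.conj R[i] \; *:%R) sV.
  exact: mul_adj_semilinear.
have sVE x y : '[sV x, y] = '[e, x ** y] by rewrite mul_adjl.
have sVV x : sV x \in V by exact: mul_adj_orth_ann.
(* [mul_adj x y] lies in [V], where [e] acts as a unit; compatibility then exchanges [e] and [y]. *)
have adjE x y : mul_adj x y = sV x ** y.
  by rewrite -[LHS]eV ?mul_adj_orth_ann // compat mulC.
have sVM x y : sV (x ** y) = sV x ** sV y.
  apply: hform_injl => // z.
  by rewrite sVE -adjE mul_adjl // sVE [y ** (x ** z)]mulA [y ** x]mulC.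
have sVC x y : '[sV x, y] = '[sV y, x] by rewrite !sVE mulC.
have sVK x : x \in V -> sV (sV x) = x.
  move=> xV; apply: hform_injl => // y.
  by rewrite sVC sVE mulC -adjE mul_adjr // mulC eV.
have sN0 x : x \in V -> sN x = 0.
  move=> /mem_orthovP xV; apply: hform_injl => // y.
  by rewrite sNC linear0l; apply/hform_eq0C/xV.
have sV0 x : x \in ann X -> sV x = 0.
  move=> /annP x0; apply: hform_injl => // y.
  by rewrite sVE x0 linear0l linear0r.
have sN_ann x y : sN x ** y = 0 by have /annP := sNA x.
(* [sV] vanishes on [ann X] and [sN] on [V], so neither alone is involutive on the whole of [X];
   values of [sN] disappear in products. *)
exists (fun x => sN x + sV x); split=> [a x y|x|x y|x y|x y z] /=.
- by rewrite sN_lin sV_lin /= scalerDr addrACA.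
- have [a [v [aA vV ->]]] := annD x.
  have -> : sN (a + v) = sN a.
    by rewrite addrC -[v]scale1r sN_lin sN0 //= scaler0 add0r.
  have -> : sV (a + v) = sV v.
    by rewrite -[a]scale1r sV_lin sV0 //= scaler0 add0r.
  rewrite -[sN a]scale1r sN_lin sV_lin /= sNK // sVK // [sN (sV v)]sN0 //.
  by rewrite [sV (sN a)]sV0 // rmorph1 !scale1r addr0 add0r.
- rewrite sN0 // add0r sVM !(linearDl, linearDr) /= sN_ann.
  by rewrite mulC sN_ann [sV x ** _]mulC sN_ann !add0r.
- by rewrite !linearDl /= sNC sVC.
- by rewrite linearDl /= sN_ann add0r -adjE mul_adjr // mulC.
Qed.

End AnnNondegenerate.

(** * Restriction of scalars, on an alias that keeps real and complex scalings apart *)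

Definition realification (R : realType) (V : vectType R[i]) : Type := V.

Section Realification.
Import VectorInternalTheory.
Variables (R : realType) (V : vectType R[i]).
Local Notation VR := (realification V).

HB.instance Definition _ := GRing.Zmodule.copy VR V.

Definition rscale (a : R) (x : VR) : VR := (a%:C *: (x : V)).

Fact rscaleA a b x : rscale a (rscale b x) = rscale (a * b) x.
Proof. by rewrite /rscale scalerA rmorphM. Qed.
Fact rscale1 : left_id 1 rscale.
Proof. by move=> x; rewrite /rscale rmorph1 scale1r. Qed.
Fact rscaleDr : right_distributive rscale +%R.
Proof. by move=> a x y; rewrite /rscale scalerDr. Qed.
Fact rscaleDl x : {morph rscale^~ x : a b / a + b}.
Proof. by move=> a b; rewrite /rscale rmorphD scalerDl. Qed.
HB.instance Definition _ :=
  GRing.Zmodule_isLmodule.Build R VR rscaleA rscale1 rscaleDr rscaleDl.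

Fact realification_vect_axiom : Vector.axiom (dim V + dim V) VR.
Proof.
pose f (x : VR) : 'rV[R]_(dim V + dim V) :=
  row_mx (map_mx (@complex.Re R) (v2r (x : V)))
    (map_mx (@complex.Im R) (v2r (x : V))).
pose g (t : 'rV[R]_(dim V + dim V)) : VR :=
  r2v (\row_k (lsubmx t 0 k +i* rsubmx t 0 k)).
exists f; last first.
  exists g => [x|t].
    rewrite /f /g row_mxKl row_mxKr -[RHS]v2rK; congr r2v.
    by apply/rowP => k; rewrite !mxE; case: (v2r _ _ _).
  rewrite /f /g r2vK -[RHS]hsubmxK; congr row_mx; apply/rowP => k;
  by rewrite !mxE.
move=> a x y; rewrite /f scale_row_mx add_row_mx.
have -> : v2r (a *: x + y : V) = a%:C *: v2r (x : V) + v2r (y : V).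
  exact: linearP.
by congr row_mx; apply/rowP => k; rewrite !mxE;
  case: (v2r (x : V) 0 k) => p q; case: (v2r (y : V) 0 k) => p' q' /=;
  rewrite mul0r ?subr0 ?addr0.
Qed.
HB.instance Definition _ :=
  Lmodule_hasFinDim.Build R VR realification_vect_axiom.

End Realification.

(** * The real algebra fixed by a conjugation, and its complexification *)

Section RealForm.
Variables (R : realType) (X : herm_alg R) (s : X -> X).
Hypothesis APK_X : APK_compatible X.
Hypothesis s_lin : linear_for (@Num.conj R[i] \; *:%R) s.
Hypothesis sK : involutive s.
Hypothesis sM : forall x y : X, s (x ** y) = s x ** s y.
Hypothesis sC : forall x y : X, '[s x, y] = '[s y, x].
Hypothesis sAdj : forall x y z : X, '[x ** y, z] = '[x, s y ** z].

Let mulC : commutative (@ha_mul R X). Proof. by case: APK_X. Qed.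
Let mulA : associative (@ha_mul R X). Proof. by case: APK_X. Qed.
Let ndX : nondegenerate (ha_form X). Proof. by case: APK_X. Qed.

Let XR := realification X.

Let conjC_real (a : R) : Num.conj (a%:C : R[i]) = a%:C.
Proof. exact: conjc_real. Qed.

(** Only real-linear, hence placed on [XR]; its kernel is the set of fixed points of [s]. *)
Let s_sub (x : XR) : XR := s x - x.
Let s_sub_linear : linear s_sub.
Proof.
move=> a x y; rewrite /s_sub.
have -> : s (a *: x + y) = a *: (s x : XR) + s y.
  by rewrite [LHS]s_lin /= conjC_real.
by rewrite scalerBr opprD addrACA.
Qed.
HB.instance Definition _ := GRing.isLinear.Build _ _ _ _ s_sub s_sub_linear.

Let fixs : {vspace XR} := lker (linfun s_sub).

Let mem_fixs x : (x \in fixs) = (s x == x).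
Proof. by rewrite memv_ker lfunE /= subr_eq0. Qed.

Let A := subvs_of fixs.
Let toX (a : A) : X := vsval a.
Let sA a : s (toX a) = toX a.
Proof. by apply/eqP; rewrite -mem_fixs subvsP. Qed.

(** Meant for fixed points of [s], where it inverts [toX]. *)
Let toA (x : X) : A := vsproj fixs x.
Let toAK x : s x = x -> toX (toA x) = x.
Proof. by move=> sx; apply: (@vsprojK _ XR fixs); rewrite mem_fixs sx. Qed.

Let toX_inj : injective toX. Proof. exact: val_inj. Qed.

Let toX_lin (k : R) (a b : A) : toX (k *: a + b) = k%:C *: toX a + toX b.
Proof. by rewrite /toX linearP. Qed.

Let Amul (a b : A) : A := toA (toX a ** toX b).
Let AmulE a b : toX (Amul a b) = toX a ** toX b.
Proof. by rewrite toAK // sM !sA. Qed.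

(** The factor cancels the [- 4] of [aff_form]. No information is lost by the real part: [sC] makes
    the hermitian form real on fixed points. *)
Let Aform (a b : A) : R := - 4^-1 * complex.Re '[toX a, toX b].
Let AformE a b : '[toX a, toX b] = (- 4 * Aform a b)%:C.
Proof.
have real_ab : Num.conj '[toX a, toX b] = '[toX a, toX b].
  by rewrite -hformC -{1}(sA b) sC sA.
rewrite /Aform mulrA mulrNN divff ?mul1r ?pnatr_eq0 //.
apply/eqP; rewrite eq_complex /= eqxx /=.
have /(congr1 (@complex.Im R)) /= := real_ab.
by case: '[_, _] => p q /= /eqP;
  rewrite eq_sym -addr_eq0 -mulr2n mulrn_eq0.
Qed.


Fact Amul_bilinear : bilinear_for
  (GRing.Scale.Law.clone _ _ *:%R _) (GRing.Scale.Law.clone _ _ *:%R _) Amul.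
Proof.
split=> [b|b] k a a'; apply: toX_inj.
  by rewrite toX_lin !AmulE toX_lin hmul_linl.
by rewrite toX_lin !AmulE toX_lin hmul_linr.
Qed.
HB.instance Definition _ :=
  bilinear_isBilinear.Build _ _ _ _ _ _ Amul Amul_bilinear.

Let Re_lin (k : R) (z w : R[i]) :
  complex.Re (k%:C * z + w) = k * complex.Re z + complex.Re w.
Proof. by case: z w => p q [p' q'] /=; rewrite mul0r subr0. Qed.

Fact Aform_bilinear : bilinear_for
  (GRing.Scale.Law.clone _ _ *%R _)
  (GRing.Scale.Law.clone _ _ (idfun \; *%R) _) Aform.
Proof.
split=> [b|b] k a a'; rewrite /Aform toX_lin;
  rewrite ?hform_linl ?hform_linr ?conjC_real.
  by rewrite Re_lin /=; ring.
by rewrite Re_lin /=; ring.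
Qed.
Fact Aform_sym a b : Aform a b = (-1) ^+ false * idfun (Aform b a).
Proof.
rewrite expr0 mul1r /= /Aform hformC AformE conjC_real -AformE.
by [].
Qed.
HB.instance Definition _ :=
  bilinear_isBilinear.Build _ _ _ _ _ _ Aform Aform_bilinear.
HB.instance Definition _ :=
  isHermitianSesquilinear.Build _ _ _ _ Aform Aform_sym.

Let RA : symm_alg R := SymmAlg Amul Aform.

Let ii : R[i] := 0 +i* 1.
Let mulii : ii * ii = -1.
Proof.
apply/eqP; rewrite eq_complex /= !mul0r !mulr0 mul1r.
by rewrite sub0r addr0 oppr0 !eqxx.
Qed.
Let conjii : Num.conj ii = - ii.
Proof. by apply/eqP; rewrite eq_complex /= oppr0 !eqxx. Qed.
Let half : R[i] := 2^-1.
Let conj_half : Num.conj half = half.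
Proof. by rewrite /half fmorphV /= conjC_nat. Qed.

Let toC (p : aff_pair RA) : X := toX p.1 + ii *: toX p.2.
Let toXD a b : toX (a + b) = toX a + toX b.
Proof. by rewrite -[a]scale1r toX_lin rmorph1 !scale1r. Qed.
Let toX0 : toX 0 = 0.
Proof. by apply: (addIr (toX 0)); rewrite -toXD !add0r. Qed.
Let toXZ k a : toX (k *: a) = k%:C *: toX a.
Proof. by rewrite -[k *: a]addr0 toX_lin toX0 addr0. Qed.
Let toXB a b : toX (a - b) = toX a - toX b.
Proof. by rewrite -scaleN1r addrC toX_lin rmorphN1 scaleN1r addrC. Qed.

Let complexE p q : p +i* q = p%:C + q%:C * ii :> R[i].
Proof.
apply/eqP; rewrite eq_complex /= !mulr0 !mul0r mulr1.
by rewrite subrr !addr0 add0r !eqxx.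
Qed.

Let toC_linear : linear toC.
Proof.
move=> [p q] [a b] [c d].
rewrite -[LHS]/(toX (p *: a - q *: b + c) + ii *: toX (p *: b + q *: a + d)).
rewrite /toC !(toXD, toXB, toXZ) complexE.
rewrite !(scalerDr, scalerDl, scalerA) -!mulrA mulii mulrN1.
rewrite scaleNr !addrA ![ii * _]mulrC.
by rewrite [LHS](ACl (1*5*4*2*3*6))%AC.
Qed.

Let s_linD x y : s (x + y) = s x + s y.
Proof. by rewrite -[x]scale1r s_lin /= rmorph1 !scale1r. Qed.
Let s0 : s 0 = 0.
Proof. by apply: (addIr (s 0)); rewrite -s_linD !add0r. Qed.
Let s_linZ c x : s (c *: x) = Num.conj c *: s x.
Proof. by rewrite -[c *: x]addr0 s_lin s0 addr0. Qed.

Let sC' (p : aff_pair RA) : s (toC p) = toX p.1 - ii *: toX p.2.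
Proof. by rewrite /toC s_linD s_linZ conjii !sA scaleNr. Qed.

(** Real and imaginary parts with respect to [s]; the second scalar is $1/(2i)$. *)
Let ofC (x : X) : aff_pair RA :=
  (toA (half *: (x + s x)), toA ((- (half * ii)) *: (x - s x))).

Let half2 (x : X) : half *: (x + x) = x.
Proof. by rewrite -mulr2n -scaler_nat scalerA mulVf ?scale1r ?pnatr_eq0. Qed.

Let ofCK : cancel ofC toC.
Proof.
move=> x; rewrite /toC /ofC /= !toAK.
- rewrite scalerA mulrN mulrCA mulii mulrN1 opprK -scalerDr.
  by rewrite addrACA subrr addr0 half2.
- rewrite s_linZ rmorphN rmorphM /= conjii conj_half mulrN opprK.
  rewrite s_linD -scaleN1r s_linZ sK rmorphN1 !scaleN1r.
  by rewrite scaleNr -scalerN opprB.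
- by rewrite s_linZ conj_half s_linD sK addrC.
Qed.

Let toCK : cancel toC ofC.
Proof.
move=> [a b]; rewrite /ofC sC' /toC /=; congr (_, _); apply: toX_inj.
  by rewrite addrACA subrr addr0 half2 toAK // sA.
rewrite opprB [toX a + _]addrC addrA addrAC addrK -scalerDr scalerA mulNr.
by rewrite -mulrA mulii mulrN1 opprK half2 toAK // sA.
Qed.

Lemma real_form_aff_pair :
  exists A : symm_alg R, symmetric_assoc_comm A /\ isomorphic X (aff_pair A).
Proof.
exists RA; split.
  split=> [a b|a b c||a b c] /=.
  - by apply: toX_inj; rewrite !AmulE mulC.
  - by apply: toX_inj; rewrite !AmulE mulA.
  - apply/eqP/vspaceP => a; rewrite memv0; apply/mem_orthovP/eqP => [a0|-> b _];
      last by rewrite linear0l.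
    (* A vector of [A] orthogonal to [A] is orthogonal to $A+iA$, which is all of [X]. *)
    apply: toX_inj; rewrite toX0; apply: hform_injl => // x; rewrite linear0l.
    have HA0 b : '[toX a, toX b] = 0 by rewrite AformE a0 ?memvf // mulr0.
    by rewrite -[x]ofCK /toC linearDr linearZr_LR /= !HA0 mulr0 addr0.
  - rewrite -[LHS]/(Aform (Amul a b) c) -[RHS]/(Aform a (Amul b c)) /Aform.
    by rewrite !AmulE sAdj sA.
apply: isomorphic_sym.
exists (HB.pack_for {linear aff_pair RA -> X} toC
  (GRing.isLinear.Build _ _ _ _ toC toC_linear)).
split=> /= [|[a b] [c d]|[a b] [c d]]; first by exists ofC.
- rewrite -[LHS]/(toX (Amul a c - Amul b d) + ii *: toX (Amul a d + Amul b c)).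
  rewrite /toC toXB toXD !AmulE !(linearDl, linearDr) /=.
  rewrite !(linearZl_LR, linearZr_LR) /= !scalerA mulii scaleN1r scalerDr.
  by rewrite !addrA [LHS](ACl (1*3*4*2))%AC.
- rewrite /toC /= !(linearDl, linearDr) /= !(linearZl_LR, linearZr_LR) /=.
  rewrite conjii !AformE; apply/eqP; rewrite eq_complex /=.
  by apply/andP; split; apply/eqP; ring.
Qed.

End RealForm.

(** * Induction on the dimension through double extensions *)

Lemma APK_classification (R : realType) (X : herm_alg R) : APK_compatible X ->
  (exists A : symm_alg R, symmetric_assoc_comm A /\ isomorphic X (aff_pair A))
  \/
  (exists A : symm_alg R,
     symmetric_assoc_comm A /\ APK_extension_series (aff_pair A) X).
Proof.
have [n] := ubnP (\dim {:X}); elim: n X => // n IHn X; rewrite ltnS => dX APK_X.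
have [K0|KN0] := eqVneq (ann X :&: orthov (ha_form X) (ann X))%VS 0%VS.
  left.
  have [s [s_lin sK sM sC sAdj]] := ann_nondegenerate_conjugation APK_X K0.
  exact: real_form_aff_pair APK_X s_lin sK sM sC sAdj.
right; have [Y [APK_Y dY extY]] := double_extension_of_ann_isotropic APK_X KN0.
have [|[A [symA isoY]]|[A [symA serY]]] := IHn Y _ APK_Y.
- exact: leq_trans dY dX.
(* [Y] is only isomorphic to [aff_pair A], but [extY] lets the series start at [aff_pair A]
   itself. *)
- by exists A; split=> //; apply: t_step; exact: extY.
exists A; split=> //; apply: t_trans serY _.
by apply: t_step; apply: extY; exact: isomorphic_refl.
Qed.

Theorem theorem5p3 (R : realType) (X : herm_alg R) (hX : APK_compatible X) :
  ((ann X :&: orthov (ha_form X) (ann X))%VS <> 0%VS ->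
     exists Y : herm_alg R, APK_double_extension Y X)
  /\
  ((exists A : symm_alg R, symmetric_assoc_comm A /\ isomorphic X (aff_pair A))
   \/
   (exists A : symm_alg R,
      symmetric_assoc_comm A /\ APK_extension_series (aff_pair A) X)).
Proof.
split=> [/eqP KN0|]; last exact: APK_classification.
have [Y [_ _ extY]] := double_extension_of_ann_isotropic hX KN0.
by exists Y; apply: extY; exact: isomorphic_refl.
Qed.
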